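(* Let $n\ge 2$. If $T_1$ and $T_2$ are two trees in some interval in $\mathscr{C}_n$, then the shortest distance between them along the edges of the rotation graph $\mathscr{R}_n$ is given by $$d_{\mathscr{R}_n}(T_1,T_2)=\mathrm{rank}(T_1)+\mathrm{rank}(T_2)-2\cdot\mathrm{rank}(T_1\wedge T_2).$$ Equivalently, this shortest distance is also given by $$d_{\mathscr{R}_n}(T_1,T_2)=2\cdot\mathrm{rank}(T_1\vee T_2)-\mathrm{rank}(T_1)-\mathrm{rank}(T_2).$$
   Context: $\mathbb{T}_n$ is the set of all full plane binary trees with $n$ leaves (every internal vertex has exactly a left child and a right child); the leaves are labeled $a_1,\ldots,a_n$ from left to right. For $T\in\mathbb{T}_n$, the reduced parenthesization $RP_T$ is the set of all subsets of $\{a_1,\ldots,a_n\}$ which are leaf sets of the subtrees of $T$ rooted at vertices of $T$ and which do not contain $a_n$. Elements of $RP_T$ of cardinality greater than $1$ are called parenthesis pairs. The (right) comb poset $\mathscr{C}_n$ is the set $\mathbb{T}_n$ ordered by $T_1\le T_2$ if and only if $RP_{T_1}\subseteq RP_{T_2}$. It has a least element, so two trees lie in a common interval exactly when they have a common upper bound. $\wedge,\vee$ denote meet and join in $\mathscr{C}_n$ (for trees in a common interval these exist). $\mathscr{C}_n$ is ranked, and $\mathrm{rank}(T)$, the rank of $T$ in $\mathscr{C}_n$, equals the number of parenthesis pairs in $RP_T$. The rotation graph $\mathscr{R}_n$ has vertex set $\mathbb{T}_n$, with two trees adjacent if one is obtained from the other by a rotation at some vertex, i.e. by replacing a subtree of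 the form $(A(BC))$ by $((AB)C)$ for subtrees $A,B,C$. $d_{\mathscr{R}_n}$ is the graph distance. *)

(* Defs.v *)
From HB Require Import structures.
From mathcomp Require Import all_boot all_order all_algebra.

Set Implicit Arguments.
Unset Strict Implicit.
Unset Printing Implicit Defensive.

Import Order.TTheory.

Inductive bintree := Leaf | Node of bintree & bintree.

Fixpoint nleaves (t : bintree) : nat :=
  if t is Node l r then nleaves l + nleaves r else 1.

Fixpoint gentree_of_bintree (t : bintree) : GenTree.tree unit :=
  if t is Node l r
  then GenTree.Node 0 [:: gentree_of_bintree l; gentree_of_bintree r]
  else GenTree.Leaf tt.

Fixpoint bintree_of_gentree (g : GenTree.tree unit) : bintree :=
  if g is GenTree.Node _ [:: l; r]
  then Node (bintree_of_gentree l) (bintree_of_gentree r)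
  else Leaf.

Lemma gentree_of_bintreeK : cancel gentree_of_bintree bintree_of_gentree.
Proof. by elim=> //= l -> r ->. Qed.

HB.instance Definition _ :=
  Countable.copy bintree (can_type gentree_of_bintreeK).

Record plane_tree (n : nat) := PlaneTree {
  bintree_of :> bintree;
  _ : nleaves bintree_of == n }.

HB.instance Definition _ n := [isSub for @bintree_of n].
HB.instance Definition _ n := [Countable of plane_tree n by <:].

Fixpoint trees_upto_height (h : nat) : seq bintree :=
  if h is h'.+1 then
    Leaf :: [seq Node l r | l <- trees_upto_height h', r <- trees_upto_height h']
  else [:: Leaf].

Lemma nleaves_gt0 t : 0 < nleaves t.
Proof. by elim: t => //= l Hl r _; rewrite addn_gt0 Hl. Qed.

Lemma mem_trees_upto_height t h : nleaves t <= h.+1 -> t \in trees_upto_height h.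
Proof.
elim: t h => [|l IHl r IHr] [|h] //=.
  by have := nleaves_gt0 l; have := nleaves_gt0 r;
     case: (nleaves l) (nleaves r) => [|a] [|b] //; rewrite addnS.
move=> Hh; rewrite inE /=; apply/allpairsP; exists (l, r) => /=.
have Hl := nleaves_gt0 l; have Hr := nleaves_gt0 r; split=> //.
- apply: IHl; rewrite -ltnS; apply: leq_trans Hh.
  by rewrite -addn1 leq_add2l.
- apply: IHr; rewrite -ltnS; apply: leq_trans Hh.
  by rewrite -add1n leq_add2r.
Qed.

Definition plane_tree_enum n : seq (plane_tree n) :=
  undup (pmap insub (trees_upto_height n)).

Lemma plane_tree_enumP n : Finite.axiom (plane_tree_enum n).
Proof.
apply: Finite.uniq_enumP; first exact: undup_uniq.
move=> [t Ht]; rewrite mem_undup mem_pmap_sub /= mem_trees_upto_height //.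
by rewrite (eqP Ht).
Qed.

HB.instance Definition _ n := isFinite.Build (plane_tree n) (@plane_tree_enumP n).

(* The leaves are numbered 0, ..., n - 1 from left to right, so that the label
   a_k is k - 1 : 'I_n.  leaf_sets n i t lists the leaf sets of the subtrees
   rooted at the vertices of t when the leftmost leaf of t has number i. *)
Fixpoint leaf_sets (n i : nat) (t : bintree) : seq {set 'I_n} :=
  [set j : 'I_n | i <= j < i + nleaves t] ::
  (if t is Node l r then leaf_sets n i l ++ leaf_sets n (i + nleaves l) r
   else [::]).

Definition reduced_parenthesization n (T : plane_tree n) : {set {set 'I_n}} :=
  [set A in leaf_sets n 0 T | [forall j in A, j.+1 != n]].

(* (first leaf number, number of leaves) of the same subtrees *)
Fixpoint blocks (i : nat) (t : bintree) : seq (nat * nat) :=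
  (i, nleaves t) ::
  (if t is Node l r then blocks i l ++ blocks (i + nleaves l) r else [::]).

Lemma leaf_setsE n i t : leaf_sets n i t =
  [seq [set j : 'I_n | b.1 <= j < b.1 + b.2] | b <- blocks i t].
Proof. by elim: t i => //= l IHl r IHr i; rewrite map_cat -IHl -IHr. Qed.

Lemma blocks_head i t : (i, nleaves t) \in blocks i t.
Proof. by case: t => [|l r] /=; rewrite inE eqxx. Qed.

Lemma blocksP t i j s : (j, s) \in blocks i t ->
  [/\ i <= j, 0 < s & j + s <= i + nleaves t].
Proof.
elim: t i j s => [|l IHl r IHr] i j s.
  by rewrite inE => /eqP[-> ->].
rewrite [blocks _ _]/= inE mem_cat => /or3P[|/IHl|/IHr].
- by case/eqP=> -> ->; rewrite (nleaves_gt0 (Node l r)).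
- case=> H1 H2 H3; split=> //.
  by apply: leq_trans H3 _; rewrite leq_add2l leq_addr.
- case=> H1 H2 H3; split=> //=; last by rewrite addnA.
  by apply: leq_trans H1; rewrite leq_addr.
Qed.

Lemma nleaves_Node_neq1 l r : nleaves (Node l r) != 1.
Proof.
have := nleaves_gt0 l; have := nleaves_gt0 r => /=.
by case: (nleaves l) (nleaves r) => [|a] [|b] //; rewrite addnS.
Qed.

Lemma blocks_inj t u i : nleaves t = nleaves u ->
  (forall j s, j + s < i + nleaves t ->
     ((j, s) \in blocks i t) = ((j, s) \in blocks i u)) -> t = u.
Proof.
elim: t u i => [|l IHl r IHr] [|l' r'] i //.
- by move=> H; have := nleaves_Node_neq1 l' r'; rewrite -H.
- by move=> H; have := nleaves_Node_neq1 l r; rewrite H.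
move=> Hn H.
have side a b j s : j + s < i + nleaves (Node a b) ->
    ((j, s) \in blocks i (Node a b)) =
    ((j, s) \in blocks i a) || ((j, s) \in blocks (i + nleaves a) b).
  move=> Hjs; rewrite [blocks _ (Node _ _)]/= inE mem_cat.
  suff -> : ((j, s) == (i, nleaves a + nleaves b)) = false by [].
  by apply/negP=> /eqP[ej es]; rewrite ej es ltnn in Hjs.
have H' j s : j + s < i + nleaves (Node l r) ->
    ((j, s) \in blocks i l) || ((j, s) \in blocks (i + nleaves l) r) =
    ((j, s) \in blocks i l') || ((j, s) \in blocks (i + nleaves l') r').
  by move=> Hjs; rewrite -!side // ?H // -Hn.
have left_le a b (c : bintree * bintree) : nleaves a + nleaves b = nleaves (Node l r) ->
    (forall j s, j + s < i + nleaves (Node l r) -> (j, s) \in blocks i a ->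
       ((j, s) \in blocks i c.1) || ((j, s) \in blocks (i + nleaves c.1) c.2)) ->
    nleaves a <= nleaves c.1.
  move=> Hab /(_ i (nleaves a)); rewrite -Hab ltn_add2l -[X in X < _]addn0.
  rewrite ltn_add2l nleaves_gt0 blocks_head => /(_ isT isT) /orP[] /blocksP[].
    by rewrite leq_add2l.
  by rewrite -[X in _ <= X]addn0 leq_add2l leqNgt nleaves_gt0.
have Hl : nleaves l = nleaves l'.
  apply/eqP; rewrite eqn_leq; apply/andP; split.
    by apply: (left_le l r (l', r')) => // j s Hjs Hb; rewrite -H' ?Hb.
  by apply: (left_le l' r' (l, r)) => // j s Hjs Hb; rewrite H' ?Hb.
have Hr : nleaves r = nleaves r'.
  by apply/eqP; rewrite -(eqn_add2l (nleaves l)) {2}Hl; apply/eqP.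
have inL a j s : (j, s) \in blocks i a -> nleaves a = nleaves l ->
    j + s <= i + nleaves l /\ 0 < s.
  by move=> /blocksP[_ ? ?] <-.
have inR a j s : (j, s) \in blocks (i + nleaves l) a -> i + nleaves l <= j.
  by case/blocksP.
have notR a j s : j + s <= i + nleaves l -> 0 < s ->
    ((j, s) \in blocks (i + nleaves l) a) = false.
  move=> Hjs Hs; apply/negP=> /inR Hj.
  by have := leq_trans Hjs Hj; rewrite -[X in _ <= X]addn0 leq_add2l leqNgt Hs.
have ltLr x : x <= i + nleaves l -> x < i + nleaves (Node l r).
  move=> Hx; apply: leq_ltn_trans Hx _.
  by rewrite /= addnA -[X in X < _]addn0 ltn_add2l nleaves_gt0.
congr Node.
- apply: (IHl _ i) => // j s Hjs.
  have [Hs|Hs] := posnP s.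
    by apply/idP/idP => /blocksP[]; rewrite Hs.
  have := H' j s (ltLr _ (ltnW Hjs)).
  by rewrite -Hl !notR ?orbF // ltnW.
- apply: (IHr _ (i + nleaves l)) => // j s Hjs.
  have notL a : nleaves a = nleaves l -> i + nleaves l <= j ->
      ((j, s) \in blocks i a) = false.
    move=> Ha Hj; apply/negP=> /inL /(_ Ha) [H1 H2].
    by have := leq_trans H1 Hj; rewrite -[X in _ <= X]addn0 leq_add2l leqNgt H2.
  have [Hj|Hj] := leqP (i + nleaves l) j.
    have := H' j s; rewrite /= addnA => /(_ Hjs).
    by rewrite -Hl !notL.
  by apply/idP/idP => /inR; rewrite leqNgt Hj.
Qed.

Lemma reduced_parenthesization_inj n : injective (@reduced_parenthesization n).
Proof.
have ivP j s j' s' : 0 < s -> j + s < n -> 0 < s' -> j' + s' <= n ->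
    [set k : 'I_n | j <= k < j + s] = [set k : 'I_n | j' <= k < j' + s'] ->
    (j, s) = (j', s').
  move=> s0 Hs s0' Hs' /setP E.
  have E' k : k < n -> (j <= k < j + s) = (j' <= k < j' + s').
    by move=> Hk; have := E (Ordinal Hk); rewrite !inE.
  have ltj a b : 0 < b -> a < a + b by move=> ?; rewrite -[X in X < _]addn0 ltn_add2l.
  have Ej : j = j'.
    apply/eqP; rewrite eqn_leq; apply/andP; split.
      have := E' j' (leq_trans (ltj _ _ s0') Hs').
      by rewrite leqnn ltj //= => /andP[].
    have := E' j (ltn_trans (ltj _ _ s0) Hs).
    by rewrite leqnn ltj //= => /esym/andP[].
  rewrite -Ej in E' Hs' *; congr pair.
  have := E' (j + s) Hs; rewrite ltnn leq_addr /= ltn_add2l => /esym/negbT.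
  rewrite -leqNgt => H1; apply/eqP; rewrite eqn_leq H1 andbT leqNgt.
  apply/negP=> H2; have := E' (j + s') (ltn_trans _ Hs).
  by rewrite !ltn_add2l H2 leq_addr ltnn => /(_ isT).
have RPP (T : plane_tree n) j s : 0 < s -> j + s < n ->
    ([set k : 'I_n | j <= k < j + s] \in reduced_parenthesization T) =
    ((j, s) \in blocks 0 T).
  move=> s0 Hs; rewrite inE leaf_setsE.
  have -> : [forall k in [set k : 'I_n | j <= k < j + s], k.+1 != n].
    apply/forall_inP => k; rewrite inE => /andP[_ Hk].
    by rewrite neq_ltn (leq_ltn_trans Hk Hs).
  rewrite andbT; apply/mapP/idP => [[[j' s'] Hb /= E]|Hb]; last by exists (j, s).
  have [_ s0' Hs'] := blocksP Hb; rewrite (ivP _ _ _ _ s0 Hs s0' _ E) //.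
  by move: Hs'; rewrite (eqP (valP T)).
move=> T U E; apply: val_inj; apply: (@blocks_inj _ _ 0).
  by rewrite (eqP (valP T)) (eqP (valP U)).
move=> j s; rewrite (eqP (valP T)) add0n => Hs.
have [s0|s0] := posnP s; last by rewrite -!RPP // E.
by apply/idP/idP => /blocksP[]; rewrite s0.
Qed.

Definition comb_le n (T1 T2 : plane_tree n) : bool :=
  reduced_parenthesization T1 \subset reduced_parenthesization T2.

Lemma comb_le_refl n : reflexive (@comb_le n).
Proof. by move=> T; apply: subxx. Qed.

Lemma comb_le_anti n : antisymmetric (@comb_le n).
Proof.
move=> T1 T2 H12; apply: reduced_parenthesization_inj.
by apply/eqP; rewrite eqEsubset.
Qed.

Lemma comb_le_trans n : transitive (@comb_le n).
Proof. by move=> T2 T1 T3; apply: subset_trans. Qed.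

Fact comb_display : Order.disp_t. Proof. exact: Order.Disp tt tt. Qed.

HB.instance Definition _ n := Order.Le_isPOrder.Build comb_display
  (plane_tree n) (@comb_le_refl n) (@comb_le_anti n) (@comb_le_trans n).

Section Poset.
Local Open Scope order_scope.
Variables (d : Order.disp_t).

Definition is_meet (P : porderType d) (x y m : P) : Prop :=
  [/\ m <= x, m <= y & forall z : P, z <= x -> z <= y -> z <= m].

Definition is_join (P : porderType d) (x y j : P) : Prop :=
  [/\ x <= j, y <= j & forall z : P, x <= z -> y <= z -> j <= z].

Definition is_chain (P : finPOrderType d) (C : {set P}) : bool :=
  [forall x in C, forall y in C, x >=< y].

(* The length (number of elements minus one) of a longest chain in the order
   ideal below x; in a ranked poset with a least element, this is the value at
   x of the rank function. *)
Definition rank (P : finPOrderType d) (x : P) : nat :=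
  (\max_(C : {set P} | is_chain C && [forall y in C, (y <= x)%O]) (#|C|).-1)%N.

End Poset.

(* All trees obtained from t by replacing one subtree (A(BC)) by ((AB)C). *)
Fixpoint left_rotations (t : bintree) : seq bintree :=
  if t is Node l r then
    (if r is Node b c then [:: Node (Node l b) c] else [::])
    ++ [seq Node l' r | l' <- left_rotations l]
    ++ [seq Node l r' | r' <- left_rotations r]
  else [::].

Definition rotation_graph n : rel (plane_tree n) := fun T1 T2 =>
  (bintree_of T2 \in left_rotations T1) || (bintree_of T1 \in left_rotations T2).

(* The least k such that some walk with k edges leads from x to y.  If there is
   a walk at all, then there is one with fewer than #|V| edges; if there is
   none, the value is #|V|. *)
Definition graph_dist (V : finType) (e : rel V) (x y : V) : nat :=
  find (fun k => [exists p : k.-tuple V, path e x p && (last x p == y)])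
       (iota 0 #|V|).

(* Main.v *)
Require Import Defs.
From mathcomp Require Import all_boot all_order all_algebra.
From mathcomp Require Import zify.

(** Write [P T] for the blocks of [T] avoiding the last leaf and [S T] for the
    first leaves of the blocks containing it.  If [T1] and [T2] have a common
    upper bound [B], then each [P Ti] is closed in [P B] under passing to
    sub-blocks, so [P T1 :&: P T2] and [P T1 :|: P T2] come from trees, the meet
    and the join.  Removing a maximal block that does not belong to a given
    closed family is a rotation, which yields a walk of length
    [|P T1 :\: P T2| + |P T2 :\: P T1|] through the meet [M].  Conversely, a rotation
    replaces a single block by another one, so at least
    [|P T1 :\: P T2| + |S T1 :\: S T2|] rotations are needed.  Since a tree has
    [2n - 1] blocks and [S M] is contained in [S T1 :|: S T2], the second summand
    is at least [|S M| - |S T2| = |P T2| - |P M| = |P T2 :\: P T1|]. *)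

Set Implicit Arguments.
Unset Strict Implicit.
Unset Printing Implicit Defensive.

Import Order.TTheory.

(** * Blocks of a tree and its right spine *)

Fixpoint pblocks (i : nat) (t : bintree) : seq (nat * nat) :=
  if t is Node l r then blocks i l ++ pblocks (i + nleaves l) r else [::].

(** A block containing the last leaf ends there, so its first leaf determines it. *)
Fixpoint spine (i : nat) (t : bintree) : seq nat :=
  i :: (if t is Node l r then spine (i + nleaves l) r else [::]).

Lemma blocks_bounds i t (b : nat * nat) : b \in blocks i t ->
  [/\ i <= b.1, 0 < b.2 & b.1 + b.2 <= i + nleaves t].
Proof. by case: b => j s; apply: blocksP. Qed.

Lemma mem_blocks_Node i l r b : (b \in blocks i (Node l r)) =
  [|| b == (i, nleaves l + nleaves r), b \in blocks i l
    | b \in blocks (i + nleaves l) r].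
Proof. by rewrite [blocks _ _]/= inE mem_cat. Qed.

Lemma blocks_uniq i t : uniq (blocks i t).
Proof.
elim: t i => //= l IHl r IHr i; rewrite cat_uniq IHl IHr mem_cat.
have l0 := nleaves_gt0 l; have r0 := nleaves_gt0 r.
rewrite andbT andTb; apply/andP; split.
  by apply/norP; split; apply/negP=> /blocks_bounds /= []; lia.
apply/hasPn => b /blocks_bounds[h1 h2 h3].
by apply/negP=> /= /blocks_bounds []; lia.
Qed.

Lemma size_blocks i t : (size (blocks i t)).+1 = (nleaves t).*2.
Proof.
elim: t i => //= l IHl r IHr i; rewrite size_cat.
by have := IHl i; have := IHr (i + nleaves l); lia.
Qed.

Lemma pblocksE i t :
  pblocks i t = [seq b <- blocks i t | b.1 + b.2 < i + nleaves t].
Proof.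
elim: t i => [|l IHl r IHr] i /=; first by rewrite ltnn.
rewrite ltnn filter_cat IHr addnA; congr (_ ++ _).
rewrite -[LHS]filter_predT; apply: eq_in_filter => b /blocks_bounds[h1 h2 h3].
have r0 := nleaves_gt0 r; symmetry; apply: (leq_ltn_trans h3); lia.
Qed.

Lemma mem_pblocks i t (b : nat * nat) :
  (b \in pblocks i t) = (b.1 + b.2 < i + nleaves t) && (b \in blocks i t).
Proof. by rewrite pblocksE mem_filter. Qed.

Lemma pblocks_uniq i t : uniq (pblocks i t).
Proof. by rewrite pblocksE filter_uniq // blocks_uniq. Qed.

Lemma perm_blocks i t : perm_eq (blocks i t)
  (pblocks i t ++ [seq (j, i + nleaves t - j) | j <- spine i t]).
Proof.
elim: t i => [|l IHl r IHr] i /=; first by rewrite addKn.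
rewrite addKn perm_sym -cat1s perm_catCA /= perm_cons -catA perm_cat2l.
by rewrite addnA perm_sym IHr.
Qed.

(** A full binary tree with [m] leaves has [2m - 1] vertices; this trades counts of spine entries
    for counts of [pblocks]. *)
Lemma size_pblocks_spine i t :
  (size (pblocks i t) + size (spine i t)).+1 = (nleaves t).*2.
Proof.
by rewrite -(size_blocks i) (perm_size (perm_blocks i t)) size_cat size_map.
Qed.

Lemma spine_bounds i t j : j \in spine i t -> i <= j < i + nleaves t.
Proof.
elim: t i => [|l IHl r IHr] i /=; rewrite inE.
  by move/eqP->; rewrite leqnn addn1 ltnSn.
by case/predU1P=> [->|/IHr]; have := nleaves_gt0 l; lia.
Qed.

Lemma spine_uniq i t : uniq (spine i t).
Proof.
elim: t i => //= l _ r IHr i; rewrite IHr andbT.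
by apply/negP=> /spine_bounds; have := nleaves_gt0 l; lia.
Qed.

Lemma mem_spine i t j : i <= j < i + nleaves t ->
  (j \in spine i t) = ((j, i + nleaves t - j) \in blocks i t).
Proof.
move=> hj; rewrite (perm_mem (perm_blocks i t)) mem_cat mem_pblocks /=.
have -> : (j + (i + nleaves t - j) < i + nleaves t) = false by lia.
by rewrite /= mem_map // => x y [].
Qed.

(** The block [b] contains both [j - 1] and [j]. For [j] strictly inside the left subtree, the block
    of that subtree serves; later positions belong to the right subtree. *)
Lemma spineN i t j : i <= j < i + nleaves t ->
  j \notin spine i t <->
  exists2 b : nat * nat, b \in pblocks i t & b.1 < j < b.1 + b.2.
Proof.
elim: t i => [|l IHl r IHr] i /= hj.
  split=> [|[]//]; rewrite inE; lia.
have l0 := nleaves_gt0 l.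
rewrite inE negb_or; split.
  case/andP=> ji; have [jl|jl] := ltnP j (i + nleaves l).
    by exists (i, nleaves l); rewrite ?mem_cat ?blocks_head //=; lia.
  case/IHr; first by lia.
  by move=> b hb ?; exists b; rewrite // mem_cat hb orbT.
case=> b; rewrite mem_cat => /orP[hb hbj|hb hbj].
  have [h1 h2 h3] := blocks_bounds hb; apply/andP; split; first by lia.
  by apply/negP=> /spine_bounds; lia.
have := hb; rewrite mem_pblocks => /andP[_ /blocks_bounds[h1 h2 h3]].
apply/andP; split; first by lia.
by apply/IHr; [lia | exists b].
Qed.

(** * Nesting and crossing of blocks *)

Definition within (b c : nat * nat) := (c.1 <= b.1) && (b.1 + b.2 <= c.1 + c.2).

Definition noncrossing (b c : nat * nat) :=
  [|| b.1 + b.2 <= c.1, c.1 + c.2 <= b.1, within b c | within c b].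

Lemma blocks_noncrossing i t (b c : nat * nat) :
  b \in blocks i t -> c \in blocks i t -> noncrossing b c.
Proof.
elim: t i b c => [|l IHl r IHr] i b c.
  by rewrite !inE => /eqP-> /eqP->; rewrite /noncrossing /within /=; lia.
move=> hb hc; have [b1 b2 b3] := blocks_bounds hb.
have [c1 c2 c3] := blocks_bounds hc; move: hb hc b3 c3.
rewrite !mem_blocks_Node [nleaves _]/=.
case/or3P=> [/eqP->|hb|hb]; [by rewrite /noncrossing /within /=; lia | |];
  (case/or3P=> [/eqP->|hc|hc]; first by rewrite /noncrossing /within /=; lia).
- by move=> *; apply: IHl hb hc.
- by have [] := blocks_bounds hb; have [] := blocks_bounds hc;
     rewrite /noncrossing; lia.
- by have [] := blocks_bounds hb; have [] := blocks_bounds hc;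
     rewrite /noncrossing; lia.
- by move=> *; apply: IHr hb hc.
Qed.

(** The blocks of a full binary tree form a maximal noncrossing family: an interval straddling the
    cut between [l] and [r] crosses one of their blocks unless it contains both, and then it is the
    whole range. *)
Lemma noncrossing_mem_blocks i t (b : nat * nat) :
  i <= b.1 -> 0 < b.2 -> b.1 + b.2 <= i + nleaves t ->
  {in blocks i t, forall c, noncrossing b c} -> b \in blocks i t.
Proof.
elim: t i b => [|l IHl r IHr] i [j s] /= h1 h2 h3 hc.
  by rewrite inE; apply/eqP; congr (_, _); lia.
have hl c : c \in blocks i l -> noncrossing (j, s) c.
  by move=> h; apply: hc; rewrite inE mem_cat h orbT.
have hr c : c \in blocks (i + nleaves l) r -> noncrossing (j, s) c.
  by move=> h; apply: hc; rewrite inE mem_cat h !orbT.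
rewrite -/(blocks i (Node l r)) mem_blocks_Node.
have [jl|jl] := leqP (j + s) (i + nleaves l); first by rewrite IHl ?orbT.
have [jr|jr] := leqP (i + nleaves l) j.
  by rewrite IHr ?orbT //=; lia.
have l0 := nleaves_gt0 l; have r0 := nleaves_gt0 r.
have := hl _ (blocks_head i l); have := hr _ (blocks_head (i + nleaves l) r).
rewrite /noncrossing /within /= => hr' hl'.
by apply/orP; left; apply/eqP; congr (_, _); lia.
Qed.

(* A sub-block of a block of [t] crosses no block of [t], hence lies in [t]. *)
Lemma pblocks_down t u (b c : nat * nat) : nleaves t = nleaves u ->
  {subset pblocks 0 t <= pblocks 0 u} ->
  c \in pblocks 0 t -> b \in pblocks 0 u -> within b c -> b \in pblocks 0 t.
Proof.
move=> tu sub hc hb bc.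
have := hc; rewrite mem_pblocks => /andP[cn ct].
have := hb; rewrite !mem_pblocks tu => /andP[bn bu]; rewrite bn /=.
have [b1 b2 b3] := blocks_bounds bu.
apply: noncrossing_mem_blocks => //; first by rewrite tu.
move=> x xt; have [x1 x2 x3] := blocks_bounds xt.
(* A block [x] inside [c] also avoids the last leaf, so it lies in [u] together with [b]. Any other
   [x] is disjoint from [c] or contains it, and likewise for [b]. *)
have := blocks_noncrossing xt ct; have [xc _|xc] := boolP (within x c).
  have := sub x; rewrite !mem_pblocks xt => /(_ _) /andP[].
    by move: xc; rewrite /within; lia.
  by move=> _ xu; apply: blocks_noncrossing xu.
by move: bc xc; rewrite /noncrossing /within; lia.
Qed.

Lemma mem_pblocks1 i t j :
  ((j, 1) \in pblocks i t) = (i <= j) && (j.+1 < i + nleaves t).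
Proof.
rewrite mem_pblocks /= addn1 andbC.
apply/andP/andP => [[/blocksP[] //]|[h1 h2]]; split=> //.
apply: noncrossing_mem_blocks => //=; first by lia.
by move=> c /blocks_bounds[]; rewrite /noncrossing /within /=; lia.
Qed.

(** * Rotations and blocks *)

Lemma left_rotations_nleaves t u : u \in left_rotations t -> nleaves u = nleaves t.
Proof.
elim: t u => //= l IHl r IHr u; rewrite !mem_cat => /or3P[].
- by case: r {IHr} => //= b c; rewrite inE => /eqP-> /=; rewrite addnA.
- by case/mapP=> l' /IHl <- ->.
- by case/mapP=> r' /IHr <- ->.
Qed.

Lemma left_rotations_blocks i t u : u \in left_rotations t ->
  exists x y s, perm_eq (blocks i t) (x :: s) /\ perm_eq (blocks i u) (y :: s).
Proof.
elim: t u i => //= l IHl r IHr u i; rewrite !mem_cat => /or3P[].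
- case: r {IHr} => //= b c; rewrite inE => /eqP-> /=.
  (* Passing from [A(BC)] to [(AB)C] trades the block of [BC] for that of [AB]. *)
  exists (i + nleaves l, nleaves b + nleaves c), (i, nleaves l + nleaves b).
  exists ((i, nleaves l + (nleaves b + nleaves c)) ::
    blocks i l ++ blocks (i + nleaves l) b ++ blocks (i + nleaves l + nleaves b) c).
  split; apply/permP => p; rewrite /= !count_cat /= ?count_cat !addnA; lia.
- case/mapP=> l' hl' ->; rewrite /= (left_rotations_nleaves hl').
  have [x [y [s [/permP h1 /permP h2]]]] := IHl _ i hl'; exists x, y.
  exists ((i, nleaves l + nleaves r) :: s ++ blocks (i + nleaves l) r).
  by split; apply/permP => p; rewrite /= !count_cat ?h1 ?h2 /=; lia.
- case/mapP=> r' hr' ->; rewrite /= (left_rotations_nleaves hr').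
  have [x [y [s [/permP h1 /permP h2]]]] := IHr _ (i + nleaves l) hr'; exists x, y.
  exists ((i, nleaves l + nleaves r) :: blocks i l ++ s).
  by split; apply/permP => p; rewrite /= !count_cat ?h1 ?h2 /=; lia.
Qed.

(** For [s] the [pblocks] of a tree, these conditions make [filter G s] the [pblocks] of a tree, up
    to order. Single leaves occur in every tree, so [G] must keep them. *)
Definition down_closed (G : pred (nat * nat)) (s : seq (nat * nat)) :=
  {in s &, forall b c, within b c -> G c -> G b} /\
  {in s, forall b, b.2 = 1 -> G b}.

(** Descend the right spine to the first left subtree whose block fails [G]. It is not a leaf, so
    [((AB)C)] can be rotated back to [(A(BC))]: the block of [AB] disappears, and that of [BC]
    contains the last leaf. *)
Lemma remove_block i t (G : pred (nat * nat)) :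
  down_closed G (pblocks i t) -> ~~ all G (pblocks i t) ->
  exists t' x, [/\ t \in left_rotations t', ~~ G x &
    perm_eq (pblocks i t) (x :: pblocks i t')].
Proof.
elim: t i => //= l _ r IHr i [dG G1].
have hin b : b \in blocks i l -> b \in blocks i l ++ pblocks (i + nleaves l) r.
  by rewrite mem_cat => ->.
have hl := blocks_head i l; have [Gl|Gl] := boolP (G (i, nleaves l)).
  rewrite all_cat negb_and => /orP[/allPn[b hb /negP[]]|hr].
    apply: (dG _ (i, nleaves l)) Gl; rewrite ?hin //.
    by have [h1 h2 h3] := blocks_bounds hb; rewrite /within /= h1.
  have [|r' [x [hr' Gx perm]]] := IHr _ _ hr.
    have hinr b : b \in pblocks (i + nleaves l) r ->
        b \in blocks i l ++ pblocks (i + nleaves l) r.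
      by rewrite mem_cat => ->; rewrite orbT.
    by split=> [b c hb hc|b hb]; [apply: dG | apply: G1]; apply: hinr.
  exists (Node l r'), x; split=> //=.
    by rewrite !mem_cat (map_f (Node l)) ?orbT.
  by rewrite perm_sym -cat1s perm_catCA /= perm_cat2l perm_sym.
move=> _; case: l hl Gl dG G1 hin => [hl /negP Gl _ G1 hin|a b _ Gl _ _ _].
  by case: Gl; apply: G1 => //; apply: hin.
exists (Node a (Node b r)), (i, nleaves (Node a b)).
by split; rewrite //= ?inE ?eqxx // perm_cons addnA catA.
Qed.

(** * The comb order in terms of blocks *)

Section Trees.
Variable n : nat.
Implicit Types T U B : plane_tree n.

Lemma nleaves_plane T : nleaves T = n. Proof. exact: (eqP (valP T)). Qed.

Definition interval_set (b : nat * nat) := [set k : 'I_n | b.1 <= k < b.1 + b.2].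

Lemma interval_set_inj b c : 0 < b.2 -> b.1 + b.2 <= n -> 0 < c.2 ->
  c.1 + c.2 <= n -> interval_set b = interval_set c -> b = c.
Proof.
case: b c => [j s] [j' s'] /= s0 hs s0' hs' /setP E.
have E' k : k < n -> (j <= k < j + s) = (j' <= k < j' + s').
  by move=> hk; have := E (Ordinal hk); rewrite !inE.
have := E' j; have := E' j'; have := E' (j + s).-1; have := E' (j' + s').-1.
by move=> *; congr (_, _); lia.
Qed.

Lemma mem_reduced_parenthesization T b : 0 < b.2 -> b.1 + b.2 < n ->
  (interval_set b \in reduced_parenthesization T) = (b \in pblocks 0 T).
Proof.
move=> s0 hs; rewrite inE leaf_setsE mem_pblocks add0n nleaves_plane hs /=.
have -> : [forall k in interval_set b, k.+1 != n].
  by apply/forall_inP => k; rewrite inE; lia.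
rewrite andbT; apply/mapP/idP => [[c hc E]|hb]; last by exists b.
have [_ c0 hc'] := blocks_bounds hc; rewrite add0n nleaves_plane in hc'.
by rewrite (@interval_set_inj b c) // ltnW.
Qed.

Lemma reduced_parenthesizationP T (A : {set 'I_n}) :
  reflect (exists2 b : nat * nat, b \in pblocks 0 T & A = interval_set b)
          (A \in reduced_parenthesization T).
Proof.
apply: (iffP idP) => [hA|[b hb ->]]; last first.
  have := hb; rewrite mem_pblocks add0n nleaves_plane => /andP[h].
  by case/blocks_bounds=> *; rewrite mem_reduced_parenthesization.
have := hA; rewrite inE leaf_setsE => /andP[/mapP[b hb E] /forall_inP h].
case: b E hb => [j s] E hb; exists (j, s) => //.
have [_ b0 b3] := blocks_bounds hb.
rewrite mem_pblocks hb andbT add0n nleaves_plane.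
rewrite /= add0n nleaves_plane in b0 b3 *.
have hk : (j + s).-1 < n by lia.
by have := h (Ordinal hk); rewrite E inE /= => /(_ _); lia.
Qed.

Lemma comb_leP T U :
  reflect {subset pblocks 0 T <= pblocks 0 U} (T <= U)%O.
Proof.
apply: (iffP idP) => [/subsetP h b hb|h]; last first.
  apply/subsetP=> A /reduced_parenthesizationP[b /h hb ->].
  by apply/reduced_parenthesizationP; exists b.
have := hb; rewrite mem_pblocks add0n nleaves_plane => /andP[bn].
case/blocks_bounds=> _ b0 _; rewrite -mem_reduced_parenthesization // h //.
by rewrite mem_reduced_parenthesization.
Qed.

(** Single leaves are counted too, so this exceeds the rank by [n.-1]. *)
Definition nblocks T := size (pblocks 0 T).

Lemma nblocks_ge T : n.-1 <= nblocks T.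
Proof.
rewrite -[n.-1](size_iota 0) -(size_map (fun j => (j, 1))).
apply: uniq_leq_size => [|b /mapP[j]].
  by rewrite map_inj_uniq ?iota_uniq // => x y [].
by rewrite mem_iota => hj ->; rewrite mem_pblocks1 nleaves_plane; lia.
Qed.

Lemma nblocks_le T U : (T <= U)%O -> nblocks T <= nblocks U.
Proof. by move/comb_leP; apply: uniq_leq_size; apply: pblocks_uniq. Qed.

Lemma nblocks_lt T U : (T < U)%O -> nblocks T < nblocks U.
Proof.
move=> TU; rewrite ltn_neqAle nblocks_le ?ltW // andbT; apply/eqP => E.
have /comb_leP sub := ltW TU.
have [] := uniq_min_size (pblocks_uniq 0 T) sub; first by rewrite -/(nblocks U) -E.
move=> _ eqm; move: (lt_geF TU) => /negbT/negP; apply.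
by apply/comb_leP=> b; rewrite eqm.
Qed.

(** * Removing blocks by rotations *)

Lemma rotation_graph_sym T U : rotation_graph T U = rotation_graph U T.
Proof. by rewrite /rotation_graph orbC. Qed.

Lemma remove_plane_block T (G : pred (nat * nat)) :
  down_closed G (pblocks 0 T) -> ~~ all G (pblocks 0 T) ->
  exists T' x, [/\ rotation_graph T T', ~~ G x &
    perm_eq (pblocks 0 T) (x :: pblocks 0 (T' : plane_tree n))].
Proof.
move=> dG nG; have [t' [x [ht' Gx perm]]] := remove_block dG nG.
have ht : nleaves t' == n by rewrite -(left_rotations_nleaves ht') nleaves_plane.
by exists (PlaneTree ht), x; split; rewrite // /rotation_graph /= ht' orbT.
Qed.

Lemma down_closed_sub (G : pred (nat * nat)) s s' :
  {subset s' <= s} -> down_closed G s -> down_closed G s'.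
Proof.
move=> sub [d1 d2]; split=> [b c hb hc|b hb]; first by apply: d1; apply: sub.
by apply: d2; apply: sub.
Qed.

(** The blocks outside [G] are removed one at a time, each by one rotation. *)
Lemma restrict_tree T (G : pred (nat * nat)) : down_closed G (pblocks 0 T) ->
  exists U p, [/\ path (@rotation_graph n) T p, last T p = U,
    size p = count (predC G) (pblocks 0 T) &
    perm_eq (pblocks 0 U) (filter G (pblocks 0 T))].
Proof.
move E: (count _ _) => k; elim: k T E => [|k IHk] T E dG.
  exists T, [::]; split=> //; have := E; move/eqP; rewrite -leqn0 leqNgt -has_count.
  by rewrite has_predC negbK => /all_filterP ->.
have nG : ~~ all G (pblocks 0 T) by rewrite -has_predC has_count E.
have [T' [x [e Gx perm]]] := remove_plane_block dG nG.
have [||U [p [hp hl hs hU]]] := IHk T'.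
- by move: E; rewrite (permP perm) /= Gx => -[].
- apply: down_closed_sub dG => b hb.
  by rewrite (perm_mem perm) inE hb orbT.
exists U, (T' :: p); split; rewrite /= ?e ?hs //.
by rewrite (perm_trans hU) // perm_sym (perm_trans (perm_filter _ perm)) //= (negbTE Gx).
Qed.

(** * Chains and the rank *)

Lemma long_chain T : exists2 C : {set plane_tree n},
  is_chain C && [forall U in C, (U <= T)%O] & #|C| = (nblocks T - n.-1).+1.
Proof.
move E: (nblocks T - n.-1) => k; elim: k T E => [|k IHk] T E.
  exists [set T]; last by rewrite cards1.
  apply/andP; split; last by apply/forall_inP=> U; rewrite inE => /eqP->.
  apply/forall_inP=> U; rewrite inE => /eqP->.
  by apply/forall_inP=> V; rewrite inE => /eqP->; rewrite comparablexx.
(* With this [G], some block of more than one leaf can be removed as long as there is one; the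
   successive trees form the chain. *)
have dG : down_closed (fun b => b.2 == 1) (pblocks 0 T).
  split=> [b c hb hc|b _ ->] //; rewrite /within => bc /eqP c1.
  have := hb; rewrite mem_pblocks => /andP[_ /blocks_bounds[_ b0 _]].
  by apply/eqP; lia.
have [|T' [x [_ _ perm]]] := remove_plane_block dG.
  apply/negP=> /allP h; move: E.
  suff : nblocks T <= n.-1 by lia.
  rewrite -[n.-1](size_iota 0) -(size_map (fun j => (j, 1))).
  apply: uniq_leq_size; first exact: pblocks_uniq.
  move=> [j s] hb; have /eqP /= s1 := h _ hb; rewrite s1 in hb *.
  apply/mapP; exists j => //; move: hb; rewrite mem_pblocks1 nleaves_plane mem_iota; lia.
have hT : nblocks T = (nblocks T').+1 by rewrite /nblocks (perm_size perm).
have T'T : (T' <= T)%O.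
  by apply/comb_leP => b hb; rewrite (perm_mem perm) inE hb orbT.
have [|C /andP[/forall_inP hC /forall_inP leC] cC] := IHk T'; first by lia.
have TC : T \notin C by apply/negP=> /leC /nblocks_le; lia.
exists (T |: C); last by rewrite cardsU1 TC cC.
have le U : U \in T |: C -> (U <= T)%O.
  by rewrite !inE => /predU1P[->//|/leC h]; apply: le_trans T'T.
apply/andP; split; last by apply/forall_inP.
apply/forall_inP=> U hU; apply/forall_inP=> V hV.
move: (hU) (hV); rewrite !inE.
case/predU1P=> [->|hU']; first by rewrite /Order.comparable le ?orbT.
case/predU1P=> [->|hV']; first by rewrite /Order.comparable le.
by have /forall_inP := hC U hU'; apply.
Qed.

(** On a chain below [T], [nblocks] is injective with values from [n.-1] to [nblocks T];
    [long_chain] attains the resulting bound. *)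
Lemma rankE T : rank T = nblocks T - n.-1.
Proof.
apply/eqP; rewrite eqn_leq; apply/andP; split; last first.
  have [C hC cC] := long_chain T.
  by rewrite /rank (bigD1 C) //= leq_max cC leqnn.
apply/bigmax_leqP => C /andP[/forall_inP hC /forall_inP leC].
suff : #|C| <= (nblocks T - n.-1).+1 by lia.
have inj : {in C &, injective nblocks}.
  move=> U V hU hV E; have /forall_inP/(_ V hV) := hC U hU.
  case/orP; rewrite le_eqVlt => /predU1P[->//|/nblocks_lt]; rewrite E ltnn //.
rewrite cardE -(size_map nblocks) -(size_iota n.-1 (nblocks T - n.-1).+1).
apply: uniq_leq_size.
  rewrite map_inj_in_uniq ?enum_uniq // => U V.
  by rewrite !mem_enum; apply: inj.
move=> k /mapP[U]; rewrite mem_enum => /leC /nblocks_le h ->.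
by rewrite mem_iota; have := nblocks_ge U; lia.
Qed.

(** A rotation replaces one block, so the count falls by at most one per step. Blocks containing the
    last leaf are included, as they contribute to the lower bound. *)
Lemma path_count_blocks (Q : pred (nat * nat)) T p :
  path (@rotation_graph n) T p ->
  count Q (blocks 0 T) <= size p + count Q (blocks 0 (last T p)).
Proof.
elim: p T => //= U p IHp T /andP[e /IHp h].
suff : count Q (blocks 0 T) <= (count Q (blocks 0 U)).+1 by lia.
by case/orP: e => /(left_rotations_blocks 0)[x [y [s [/permP-> /permP->]]]] /=; lia.
Qed.

End Trees.

(** * Graph distance and walks *)

Section GraphDist.
Variables (V : finType) (e : rel V).

Lemma graph_dist_le x p : path e x p -> graph_dist e x (last x p) <= size p.
Proof.
move=> hp; rewrite /graph_dist; set a := (X in find X).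
(* For a walk of [#|V|] or more edges, the bound [#|V|] on any result of [find] suffices. *)
have [hV|hV] := leqP #|V| (size p).
  by apply: leq_trans (find_size _ _) _; rewrite size_iota.
rewrite leqNgt; apply/negP=> /(before_find 0); rewrite nth_iota // add0n.
by move/negbT/negP; apply; rewrite /a; apply/existsP; exists (in_tuple p); rewrite hp eqxx.
Qed.

Lemma graph_dist_path x p : path e x p ->
  exists q, [/\ path e x q, last x q = last x p
              & size q = graph_dist e x (last x p)].
Proof.
move=> hp; rewrite /graph_dist; set a := (X in find X).
have ha : has a (iota 0 #|V|).
  (* A walk without repeated vertices has fewer than [#|V|] edges, so its length is in the search
     range. *)
  rewrite /a; case/shortenP: hp => q hq uq _; apply/hasP; exists (size q).
    by rewrite mem_iota /= add0n -[_.+1]/(size (x :: q)) -(card_uniqP uq) max_card.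
  by apply/existsP; exists (in_tuple q); rewrite hq eqxx.
have := nth_find 0 ha; rewrite nth_iota ?add0n; last first.
  by rewrite -[X in _ < X](size_iota 0) -has_find.
rewrite {1}/a; case/existsP=> q /andP[hq /eqP lq]; exists q; split=> //; exact: size_tuple.
Qed.

End GraphDist.

(** * The distance formula *)

Theorem theorem4p4 (n : nat) (hn : 2 <= n) (T1 T2 : plane_tree n)
  (hint : exists A B : plane_tree n,
     (A <= T1 <= B)%O /\ (A <= T2 <= B)%O) :
  exists M J : plane_tree n,
    [/\ is_meet T1 T2 M, is_join T1 T2 J,
        Posz (graph_dist (@rotation_graph n) T1 T2)
          = (Posz (rank T1) + Posz (rank T2) - 2 * Posz (rank M))%R
      & Posz (graph_dist (@rotation_graph n) T1 T2)
          = (2 * Posz (rank J) - Posz (rank T1) - Posz (rank T2))%R].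
Proof.
case: hint => _ [B [/andP[_ h1] /andP[_ h2]]].
have sub1 := comb_leP _ _ h1; have sub2 := comb_leP _ _ h2.
have nl (T U : plane_tree n) : nleaves T = nleaves U.
  by rewrite !nleaves_plane.
have sgl (T U : plane_tree n) b : b \in pblocks 0 T -> b.2 = 1 ->
    b \in pblocks 0 U.
  by case: b => j s /= hb s1; move: hb; rewrite s1 !mem_pblocks1 (nl T U).
have dc (T U : plane_tree n) : (T <= B)%O -> (U <= B)%O -> down_closed (mem (pblocks 0 U)) (pblocks 0 T).
  move=> /comb_leP hT /comb_leP hU; split=> [b c hb hc bc cU|b]; last exact: sgl.
  exact: pblocks_down (nl _ _) hU cU (hT _ hb) bc.
have [M [p1 [hp1 lp1 sp1 pM]]] := restrict_tree (dc _ _ h1 h2).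
have [M' [p2 [hp2 lp2 sp2 pM']]] := restrict_tree (dc _ _ h2 h1).
have mM b : (b \in pblocks 0 M) = (b \in pblocks 0 T1) && (b \in pblocks 0 T2).
  by rewrite (perm_mem pM) mem_filter andbC.
(* Restricting [T1] to the blocks of [T2], or [T2] to those of [T1], keeps the same blocks, so both
   descents end at the meet. *)
have EM : M' = M.
  apply: le_anti; apply/andP; split; apply/comb_leP=> b;
  by rewrite mM (perm_mem pM') mem_filter.
(* The join is [B] restricted to the union. *)
pose G b := (b \in pblocks 0 T1) || (b \in pblocks 0 T2).
have dG : down_closed G (pblocks 0 B).
  have [d1 s1] := dc B T1 (lexx _) h1; have [d2 s2] := dc B T2 (lexx _) h2.
  split=> [b c hb hc bc|b hb b1]; last by apply/orP; left; apply: s1.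
  by case/orP=> [/(d1 _ _ hb hc bc)|/(d2 _ _ hb hc bc)] h; apply/orP; [left|right].
have [J [_ [_ _ _ pJ]]] := restrict_tree dG.
have mJ b : (b \in pblocks 0 J) = (b \in pblocks 0 T1) || (b \in pblocks 0 T2).
  rewrite (perm_mem pJ) mem_filter andb_idr //.
  by case/orP=> [/sub1|/sub2].
have cnt (T U : plane_tree n) : count (predC (mem (pblocks 0 U))) (pblocks 0 T) +
    count (mem (pblocks 0 U)) (pblocks 0 T) = nblocks T.
  by rewrite addnC count_predC.
have n1 : count (predC (mem (pblocks 0 T2))) (pblocks 0 T1) + nblocks M = nblocks T1.
  by rewrite -(cnt T1 T2) /nblocks (perm_size pM) size_filter.
have n2 : count (predC (mem (pblocks 0 T1))) (pblocks 0 T2) + nblocks M = nblocks T2.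
  by rewrite -(cnt T2 T1) -EM /nblocks (perm_size pM') size_filter.
(* Inclusion-exclusion, with all blocks counted inside [pblocks 0 B]. *)
have nJ : nblocks J + nblocks M = nblocks T1 + nblocks T2.
  have cB (T : plane_tree n) : (T <= B)%O -> nblocks T = count (mem (pblocks 0 T)) (pblocks 0 B).
    move=> /comb_leP hT; rewrite -size_filter; apply: perm_size.
    apply: uniq_perm; rewrite ?filter_uniq ?pblocks_uniq // => b.
    by rewrite mem_filter andb_idr // => /hT.
  have hM : (M <= B)%O by apply/comb_leP=> b; rewrite mM => /andP[/sub1].
  have hJ : (J <= B)%O by apply/comb_leP=> b; rewrite mJ => /orP[/sub1|/sub2].
  rewrite (cB _ h1) (cB _ h2) -count_predUI !cB //; congr (_ + _).
    by apply: eq_count => b; rewrite /= mJ.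
  by apply: eq_count => b; rewrite /= mM.
(* If blocks [b1] of [T1] and [b2] of [T2] both contain [j - 1] and [j], then
   they are nested, and the smaller one is common to [T1] and [T2]. *)
have sM : {subset spine 0 M <= spine 0 T1 ++ spine 0 T2}.
  move=> j jM; have jn := spine_bounds jM; apply: contraLR jM.
  rewrite mem_cat negb_or => /andP[].
  case/spineN=> [|b1 hb1 jb1]; first by rewrite (nl T1 M).
  case/spineN=> [|b2 hb2 jb2]; first by rewrite (nl T2 M).
  apply/spineN => //.
  have [u1 u2] := (sub1 _ hb1, sub2 _ hb2).
  have := u1; have := u2; rewrite !mem_pblocks => /andP[_ v2] /andP[_ v1].
  have [w|w] := boolP (within b1 b2).
    exists b1 => //; rewrite mM hb1.
    exact: pblocks_down (nl _ _) sub2 hb2 u1 w.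
  exists b2 => //; rewrite mM hb2 andbT.
  apply: pblocks_down (nl _ _) sub1 hb1 u2 _.
  by move: (blocks_noncrossing v1 v2) w; rewrite /noncrossing /within; lia.
have lower : count (predC (mem (pblocks 0 T2))) (pblocks 0 T1) +
    count (predC (mem (pblocks 0 T1))) (pblocks 0 T2)
    <= count (predC (mem (blocks 0 T2))) (blocks 0 T1).
  (* Split the blocks of [T1] by whether they contain the last leaf; those that do are compared
     through their first leaves. *)
  rewrite (permP (perm_blocks 0 T1)) count_cat; apply: leq_add.
    apply: eq_leq; apply: eq_in_count => b; rewrite /= !mem_pblocks.
    by rewrite (nl T1 T2) => /andP[-> _].
  rewrite count_map.
  have -> : count (preim (fun j => (j, 0 + nleaves T1 - j))
      (predC (mem (blocks 0 T2)))) (spine 0 T1) =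
      count (fun j => j \notin spine 0 T2) (spine 0 T1).
    apply: eq_in_count => j /spine_bounds hj /=.
    by rewrite mem_spine (nl T2 T1).
  (* By [sM], [|S M|] is at most [|S T1 \ S T2| + |S T2|]. *)
  have : size (spine 0 M) <= size ([seq j <- spine 0 T1 | j \notin spine 0 T2] ++ spine 0 T2).
    apply: uniq_leq_size; first exact: spine_uniq.
    move=> j /sM; rewrite !mem_cat mem_filter.
    by case: (j \in spine 0 T2); rewrite ?orbT.
  rewrite size_cat size_filter.
  have := size_pblocks_spine 0 M; have := size_pblocks_spine 0 T2.
  rewrite (nl T2 M) -/(nblocks M) -/(nblocks T2) => s2 s0 hs.
  rewrite -(leq_add2r (size (spine 0 T2))); apply: leq_trans hs.
  lia.
have sym : symmetric (@rotation_graph n) by move=> x y; exact: rotation_graph_sym.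
(* Descend from [T1] to [M], then follow the walk from [T2] backwards; [belast] drops the second
   copy of [M]. *)
have hp : path (@rotation_graph n) T1 (p1 ++ rev (belast T2 p2)).
  rewrite cat_path hp1 lp1 -EM -lp2 rev_path.
  by rewrite (eq_path (e' := @rotation_graph n)) // => x y; rewrite sym.
have lp : last T1 (p1 ++ rev (belast T2 p2)) = T2.
  rewrite last_cat lp1 -EM -lp2; case: (p2) => //= x s.
  by rewrite rev_cons last_rcons.
have up := graph_dist_le hp.
rewrite lp size_cat size_rev size_belast sp1 sp2 in up.
have [q [hq lq sq]] := graph_dist_path hp; rewrite lp in lq sq.
have := path_count_blocks (predC (mem (blocks 0 T2))) hq.
have -> : count (predC (mem (blocks 0 T2))) (blocks 0 (last T1 q)) = 0.
  rewrite lq; apply/eqP; rewrite -leqn0 leqNgt -has_count has_predC negbK.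
  exact/allP.
rewrite sq addn0 => /(leq_trans lower) low.
have dist : graph_dist (@rotation_graph n) T1 T2 + (nblocks M + nblocks M) =
    nblocks T1 + nblocks T2.
  by rewrite (anti_leq (introT andP (conj up low))) addnACA n1 n2.
(* These bounds make the truncated subtraction in [rankE] exact. *)
have g1 := nblocks_ge T1; have g2 := nblocks_ge T2.
have gM := nblocks_ge M; have gJ := nblocks_ge J.
exists M, J; split; rewrite ?rankE.
- split; try by apply/comb_leP=> b; rewrite mM => /andP[].
  move=> Z /comb_leP z1 /comb_leP z2; apply/comb_leP=> b hb.
  by rewrite mM z1 ?z2.
- split; try by apply/comb_leP=> b; rewrite mJ => ->; rewrite ?orbT.
  move=> Z /comb_leP z1 /comb_leP z2; apply/comb_leP=> b.
  by rewrite mJ => /orP[/z1|/z2].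
- lia.
- lia.
Qed.
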